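(* Let $X_i=\mu+\sigma_i e_i$, $i=1,\ldots,n$, be a modulated stationary process for which the strong invariance principle holds with approximation error $\Delta_n$, i.e. there are standard Brownian motions $\{B_t\}$ and $\{B^*_t\}$ with $$\max_{1\le i\le n}|S_i-\tau B_i|=o_{\mathrm{a.s.}}(\Delta_n)\quad\text{and}\quad \max_{1\le i\le n}|S^*_i-\tau^*B^*_i|=o_{\mathrm{a.s.}}(\Delta_n).$$ Then for any $c\in(0,1]$, as $n\to\infty$, $$\max_{cn\le j\le n}\Bigl|F_j-\tau\sum_{i=1}^j\sigma_i(B_i-B_{i-1})\Bigr|=O_{\mathrm{a.s.}}(r_n\Delta_n),$$ $$\max_{cn\le j\le n}\bigl|\underline{V}_j^2-\Sigma_j^2\bigr|=O_{\mathrm{p}}\bigl\{(r_n^2\Delta_n^2+\Sigma_n^2)/n+\Sigma_n^{*2}+r_n^*\Delta_n\bigr\}.$$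
   Context: Setting: $\{e_i\}$ is a stationary time series with $E(e_i)=0$, $E(e_i^2)=1$; $\mu\in\mathbb{R}$ is a constant; $\sigma_i>0$ are deterministic constants (which may depend on $n$). Set $S_0=S_0^*=0$, $S_i=\sum_{j=1}^i e_j$, $S_i^*=\sum_{j=1}^i(e_j^2-1)$. $\tau^2$ and $\tau^{*2}$ are the long-run variances of $\{e_i\}$ and $\{e_i^2-1\}$ (assumed well defined), where the long-run variance of a stationary process with autocovariances $\gamma_k$ is $\gamma_0+2\sum_{k\ge1}\gamma_k$; it is assumed that $\tau^2>0$, and $\tau>0$, $\tau^*\ge 0$ denote the square roots. $\Delta_n$ is a positive sequence. Strong invariance principles are understood, as usual, on a possibly enlarged probability space on which the process is redefined without changing its distribution; the two Brownian motions may be defined on different probability spaces and no assumption is made on their joint distribution. $B_0=B_0^*=0$. Notation: $F_j=j(\underline{X}_j-\mu)$, $\underline{X}_j=j^{-1}\sum_{i=1}^jX_i$, $\underline{V}_j^2=\sum_{i=1}^j(X_i-\underline{X}_j)^2$; $r_n=|\sigma_n|+\sum_{i=2}^n|\sigma_i-\sigma_{i-1}|$, $r_n^*=|\sigma_n^2|+\sum_{i=2}^n|\sigma_i^2-\sigma_{i-1}^2|$; $\Sigma_j^2=\sum_{i=1}^j\sigma_i^2$, $\Sigma_j^{*2}=\bigl(\sum_{i=1}^j\sigma_i^4\bigr)^{1/2}$. $o_{\mathrm{a.s.}}$, $O_{\mathrm{a.s.}}$ and $O_{\mathrm{p}}$ denote the usual almost sure and in-probability orders as $n\to\infty$; $j$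 ranges over integers. *)

(* Defs.v *)
From HB Require Import structures.
From mathcomp Require Import all_boot all_order all_algebra.
From mathcomp Require Import all_classical all_reals all_analysis.

Set Implicit Arguments.
Unset Strict Implicit.
Unset Printing Implicit Defensive.

Import Order.TTheory GRing.Theory Num.Theory.
Import numFieldNormedType.Exports.

Local Open Scope classical_set_scope.
Local Open Scope ring_scope.

(* A time series is e : nat -> T -> R, of which only e 1, e 2, ... matter:
   e 0 is unconstrained and never used. *)

Section Processes.
Context {R : realType}.

(* Equality of all finite-dimensional distributions of (e_i)_{i >= 1}; the
   sigma-algebra on n.-tuple R is the product one. *)
Definition same_law (d d' : measure_display)
    (T : measurableType d) (P : probability T R) (e : nat -> T -> R)
    (T' : measurableType d') (P' : probability T' R) (e' : nat -> T' -> R) :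
    Prop :=
  forall (n : nat) (A : set (n.-tuple R)), measurable A ->
    P [set w | A [tuple e i.+1 w | i < n]] =
    P' [set w | A [tuple e' i.+1 w | i < n]].

Context {d : measure_display} {T : measurableType d} (P : probability T R).

Definition stationary (e : nat -> T -> R) : Prop :=
  forall h : nat, same_law P e P (fun i => e (i + h)%N).

Definition autocov (Y : nat -> T -> R) (k : nat) : R :=
  fine (covariance P (Y 1%N) (Y k.+1)).

(* The long-run variance of the stationary process Y is well defined and
   equal to v. *)
Definition is_long_run_variance (Y : nat -> T -> R) (v : R) : Prop :=
  (forall i, (1 <= i)%N -> Y i \in Lfun P 2%:E) /\
  (fun m => autocov Y 0 + 2 * \sum_(1 <= k < m.+1) autocov Y k) @ \oo --> v.

Definition mutually_independent (n : nat) (Y : 'I_n -> T -> R) : Prop :=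
  forall A : 'I_n -> set R, (forall i, measurable (A i)) ->
    P (\bigcap_(i in [set: 'I_n]) (Y i @^-1` A i)) =
    (\prod_(i < n) P (Y i @^-1` A i))%E.

(* Time ranges over [0, +oo[; B t is unconstrained for t < 0. *)
Record standard_brownian_motion (B : R -> {RV P >-> R}) : Prop :=
  StandardBrownianMotion {
    bm_start : {ae P, forall w, B 0 w = 0} ;
    bm_normal : forall s t : R, 0 <= s -> s < t ->
      forall A : set R, measurable A ->
        P [set w | A (B t w - B s w)] = normal_prob 0 (Num.sqrt (t - s)) A ;
    bm_independent : forall (n : nat) (t : nat -> R), 0 <= t 0%N ->
      {homo t : i j / (i <= j)%N >-> i <= j} ->
      mutually_independent (fun (i : 'I_n) w => B (t i.+1) w - B (t i) w) ;
    bm_continuous :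
      {ae P, forall w, {within `[0, +oo[, continuous (fun t => B t w)}} }.

(* o_{a.s.}(a_n), O_{a.s.}(a_n) and O_p(a_n); in the almost sure cases the rate
   of convergence, resp. the constant, may depend on the outcome w. *)
Definition as_littleo (Y : nat -> T -> R) (a : nat -> R) : Prop :=
  {ae P, forall w, (fun n => Y n w) =o_\oo a}.

Definition as_bigO (Y : nat -> T -> R) (a : nat -> R) : Prop :=
  {ae P, forall w, (fun n => Y n w) =O_\oo a}.

Definition p_bigO (Y : nat -> T -> R) (a : nat -> R) : Prop :=
  forall eps : R, 0 < eps -> exists2 M : R, 0 < M &
    \forall n \near \oo, (P [set w | (M * `|a n| < `|Y n w|)%R] <= eps%:E)%E.

Definition partial_sum (e : nat -> T -> R) (i : nat) (w : T) : R :=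
  \sum_(1 <= j < i.+1) e j w.

Definition strong_approx (e : nat -> T -> R) (tau : R)
    (B : R -> {RV P >-> R}) (Delta : nat -> R) : Prop :=
  as_littleo
    (fun n w => \big[Num.max/0]_(1 <= i < n.+1)
                  `|partial_sum e i w - tau * B i%:R w|)
    Delta.

(* In the definitions below X is the n-th row X_1, ..., X_n of the observations
   and s the n-th row sigma_1, ..., sigma_n of the scales. *)
Definition modulated (mu : R) (s : nat -> R) (e : nat -> T -> R)
    (i : nat) (w : T) : R := mu + s i * e i w.

Definition sample_mean (X : nat -> T -> R) (j : nat) (w : T) : R :=
  j%:R^-1 * \sum_(1 <= i < j.+1) X i w.

Definition centered_sum (mu : R) (X : nat -> T -> R) (j : nat) (w : T) : R :=
  j%:R * (sample_mean X j w - mu).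

Definition sum_sq_dev (X : nat -> T -> R) (j : nat) (w : T) : R :=
  \sum_(1 <= i < j.+1) (X i w - sample_mean X j w) ^+ 2.

Definition modulated_bm (s : nat -> R) (B : R -> {RV P >-> R})
    (j : nat) (w : T) : R :=
  \sum_(1 <= i < j.+1) s i * (B i%:R w - B i.-1%:R w).

End Processes.

Section Rates.
Context {R : realType}.

(* r_n is [end_variation sigma_n n] and r_n^* is the same functional of the
   squares sigma_i ^ 2. *)
Definition end_variation (s : nat -> R) (n : nat) : R :=
  `|s n| + \sum_(2 <= i < n.+1) `|s i - s i.-1|.

(* Sigma2 and Sigmastar2 are the squared quantities Sigma_j^2, Sigma_j^{*2}. *)
Definition Sigma2 (s : nat -> R) (j : nat) : R :=
  \sum_(1 <= i < j.+1) s i ^+ 2.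

Definition Sigmastar2 (s : nat -> R) (j : nat) : R :=
  Num.sqrt (\sum_(1 <= i < j.+1) s i ^+ 4).

(* The maximum of the nonnegative f j over the integers c n <= j <= n. *)
Definition max_from (c : R) (n : nat) (f : nat -> R) : R :=
  \big[Num.max/0]_(j < n.+1 | c * n%:R <= j%:R) f j.

End Rates.

(* Main.v *)
Require Import Defs.
From HB Require Import structures.
From mathcomp Require Import all_boot all_order all_algebra.
From mathcomp Require Import all_classical all_reals all_analysis.
From mathcomp Require Import measurable_realfun.
From mathcomp Require Import ring lra.
Import Order.TTheory GRing.Theory Num.Theory.
Import numFieldNormedType.Exports.
Local Open Scope classical_set_scope.
Local Open Scope ring_scope.

(** Both estimates come from one pathwise bound. Summation by parts expresses
    [\sum_(i <= j) s i * y i] through the partial sums of [y], the weights being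
    [s j] and the increments of [s]; hence, uniformly in [j <= n], it is at most
    [end_variation s n] times the largest of the first [n] partial sums
    ([weighted_sum_le]). Applied to [y i - tau * (B i - B (i - 1))], whose partial
    sums are exactly what the strong approximation controls, this says that
    almost surely, for all large [n], [\sum_(i <= j) s i * y i] is within
    [end_variation s n * Delta n] of the Brownian sum
    [tau * \sum_(i <= j) s i * (B i - B (i - 1))]
    ([weighted_sum_strong_approx]). Since [F_j = \sum_(i <= j) sigma_i e_i],
    this is the almost sure estimate.

    For the sample variance, expanding the squares gives
    [V_j^2 - Sigma_j^2 = \sum_(i <= j) sigma_i^2 (e_i^2 - 1) - F_j^2 / j]
    ([modulated_sum_sq_dev]), and [F_j^2 / j <= F_j^2 / (c n)] on the range of
    the maximum. Both [max |F_j|] and the maximum of the first sum are maxima of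
    weighted sums of a strongly approximated series, so it suffices to show that
    such a maximum is [O_p(end_variation s n * Delta n + sqrt (\sum s_i^2))]
    ([weighted_sum_p_bigO]). The first term is the approximation error; the
    second comes from Kolmogorov's maximal inequality for the Brownian sum.
    The two series involved live on two different probability spaces, and each
    bound is carried back to the original space separately, because it only
    concerns the law of finitely many coordinates ([same_law_p_bigO]).

    Kolmogorov's inequality is proved here for independent symmetric increments
    with bounded second moments ([kolmogorov_inequality]). Symmetry replaces
    conditional expectations: flipping the sign of the last increment does not
    change the law of the family ([sign_flip_law]), so the cross term in the
    second moment of the stopped sum cancels by the parallelogram identity,
    within integrals of nonnegative functions. *)

Set Implicit Arguments.
Unset Strict Implicit.
Unset Printing Implicit Defensive.

(** * Maxima of finite families *)

Section Maxima.
Context {R : realType}.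

Lemma bigmax_nat_le m n (F : nat -> R) x : 0 <= x ->
  (forall i, (m <= i < n)%N -> F i <= x) ->
  \big[Num.max/0]_(m <= i < n) F i <= x.
Proof. by move=> x0 Fx; rewrite big_nat; apply: bigmax_le. Qed.

Lemma le_bigmax_nat_term m n (F : nat -> R) i : (m <= i < n)%N ->
  F i <= \big[Num.max/0]_(m <= i < n) F i.
Proof. by move=> mn; apply: le_bigmax_seq; rewrite ?mem_index_iota. Qed.

Lemma measurable_bigmax d (T : measurableType d) I (r : seq I) (p : pred I)
    (f : I -> T -> R) x : (forall i, measurable_fun setT (f i)) ->
  measurable_fun setT (fun w => \big[Num.max/x]_(i <- r | p i) f i w).
Proof.
move=> mf; elim: r => [|i r IH].
  by under eq_fun do rewrite big_nil; exact: measurable_cst.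
under eq_fun do rewrite big_cons.
case: (p i) => //; exact: measurable_maxr.
Qed.

Lemma measurable_gt d (T : measurableType d) (f : T -> R) x :
  measurable_fun setT f -> measurable [set w | x < f w].
Proof.
move=> mf; rewrite (_ : [set w | _] = f @^-1` `]x, +oo[%classic).
  by rewrite -[X in measurable X]setTI; exact: mf.
by apply/seteqP; split=> w /=; rewrite in_itv/= andbT.
Qed.

Lemma measurable_gt_norm d (T : measurableType d) (f : T -> R) x :
  measurable_fun setT f -> measurable [set w | x < `|f w|].
Proof. by move=> mf; apply: measurable_gt; exact: measurableT_comp. Qed.

End Maxima.

(** * Summation by parts and the sample variance *)

Section Deterministic.
Context {R : realType}.
Implicit Types (s y : nat -> R) (n j : nat).

Lemma summation_by_parts s y j : (1 <= j)%N ->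
  \sum_(1 <= i < j.+1) s i * y i =
  s j * (\sum_(1 <= k < j.+1) y k) -
  \sum_(2 <= i < j.+1) (s i - s i.-1) * \sum_(1 <= k < i) y k.
Proof.
elim: j => // -[_ _|j /(_ isT) IH _].
  by rewrite !big_nat1 big_geq ?subr0.
rewrite big_nat_recr//= IH [in RHS]big_nat_recr//= [X in _ = _ - X]big_nat_recr//=.
ring.
Qed.

Lemma end_variation_ge0 s n : 0 <= end_variation s n.
Proof. by rewrite addr_ge0// sumr_ge0. Qed.

(** From [n] to [n - 1] the terms [|s n| + |s n - s (n - 1)|] are replaced by
    [|s (n - 1)|], which is smaller by the triangle inequality; this makes the
    bound on weighted sums uniform in the endpoint. *)
Lemma end_variation_le s j n : (1 <= j <= n)%N ->
  end_variation s j <= end_variation s n.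
Proof.
move=> /andP[j1 jn]; rewrite -(subnKC jn); elim: (n - j)%N => [|k IH].
  by rewrite addn0.
apply: (le_trans IH); rewrite addnS /end_variation.
rewrite [X in _ <= _ + X]big_nat_recr/=; last by rewrite ltnS ltn_addr.
have := ler_normB (s (j + k).+1) (s (j + k).+1 - s (j + k)%N).
rewrite subKr; lra.
Qed.

(** In the summation by parts the coefficients of the partial sums are [s j] and
    the increments of [s], whose absolute values add up to [end_variation s j]. *)
Lemma weighted_sum_le s y n j (D : R) : (1 <= j <= n)%N ->
  (forall i, (1 <= i <= n)%N -> `|\sum_(1 <= k < i.+1) y k| <= D) ->
  `|\sum_(1 <= i < j.+1) s i * y i| <= end_variation s n * D.
Proof.
move=> /[dup] jn /andP[j1 jn'] yD; rewrite summation_by_parts//.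
have D0 : 0 <= D by exact: le_trans (yD j jn).
apply: (@le_trans _ _ (end_variation s j * D)); last first.
  by rewrite ler_wpM2r// end_variation_le.
rewrite mulrDl mulr_suml (le_trans (ler_normB _ _))// lerD//.
  by rewrite normrM ler_wpM2l// yD.
apply: (le_trans (ler_norm_sum _ _ _)); apply: ler_sum_nat => -[//|i] /andP[i2 ij].
rewrite normrM ler_wpM2l// yD//.
by rewrite -ltnS i2 ltnW// (leq_trans _ jn').
Qed.

Lemma modulated_centered_sum d (T : measurableType d) (mu : R) s
    (e : nat -> T -> R) j w : (1 <= j)%N ->
  centered_sum mu (modulated mu s e) j w = \sum_(1 <= i < j.+1) s i * e i w.
Proof.
move=> j1; rewrite /centered_sum /sample_mean /modulated big_split/=.
rewrite sumr_const_nat subn1/= mulrBr mulrA divff ?mul1r; last first.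
  by rewrite pnatr_eq0 -lt0n.
by rewrite mulr_natl [X in X - _]addrC addrK.
Qed.

Lemma modulated_sum_sq_dev d (T : measurableType d) (mu : R) s
    (e : nat -> T -> R) j w : (1 <= j)%N ->
  sum_sq_dev (modulated mu s e) j w - Sigma2 s j =
  \sum_(1 <= i < j.+1) s i ^+ 2 * (e i w ^+ 2 - 1) -
  (\sum_(1 <= i < j.+1) s i * e i w) ^+ 2 / j%:R.
Proof.
move=> j1; have j0 : j%:R != 0 :> R by rewrite pnatr_eq0 -lt0n.
have := modulated_centered_sum mu s e w j1; rewrite /centered_sum.
move=> /(canRL (mulKf j0)) /(canRL (subrK _)) mE.
rewrite /sum_sq_dev mE /modulated; set m := \sum_(1 <= i < j.+1) s i * e i w.
under eq_bigr => i _.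
  rewrite (_ : _ ^+ 2 = s i ^+ 2 * (e i w ^+ 2 - 1) + s i ^+ 2
     - 2 * (j%:R^-1 * m) * (s i * e i w) + (j%:R^-1 * m) ^+ 2); last by ring.
  over.
rewrite !big_split/= sumrN -mulr_sumr -/m sumr_const_nat subn1/= -/(Sigma2 s j).
by rewrite -[_ *+ j]mulr_natl; field.
Qed.

End Deterministic.

(** * Laws of random tuples *)

Section TupleLaws.
Context {R : realType}.

(** The product sigma-algebra is defined from preimages of single coordinates;
    the rectangles generate it as well and are stable under intersection, as the
    uniqueness theorem for measures requires. *)
Lemma measurable_tuple_rectangles n :
  @measurable _ (n.-tuple R) =
  <<s [set X | exists2 A : 'I_n -> set R, (forall i, measurable (A i)) &
        X = [set x : n.-tuple R | forall i, A i (tnth x i)]] >>.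
Proof.
apply/seteqP; split.
- apply: smallest_sub; first exact: smallest_sigma_algebra.
  move=> X; rewrite -bigcup_seq => -[i _ [Y mY <-]].
  apply: sub_sigma_algebra; exists (fun k => if k == i then Y else setT).
    by move=> k; case: ifP.
  rewrite setTI; apply/seteqP; split=> x /= Yx.
    by move=> k; case: ifP => // /eqP ->.
  by have := Yx i; rewrite eqxx.
- apply: smallest_sub; first exact: sigma_algebra_measurable.
  move=> _ [A mA ->].
  rewrite (_ : [set x | _] = \bigcap_(i in [set: 'I_n]) [set x | A i (tnth x i)]).
    apply: fin_bigcap_measurable => // i _.
    by rewrite -[X in measurable X]setTI; exact: (measurable_tnth i).
  by apply/seteqP; split=> x /= Ax i; [move=> _|]; exact: Ax.
Qed.

Lemma measurable_mktuple d (T : measurableType d) n (Y : 'I_n -> T -> R) :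
  (forall i, measurable_fun setT (Y i)) ->
  measurable_fun setT (fun w => [tuple Y i w | i < n]).
Proof.
move=> mY; apply/measurable_fun_tnthP => i.
by rewrite (_ : _ \o _ = Y i)//; apply/funext => w/=; rewrite tnth_mktuple.
Qed.

Lemma measurable_nth0 n k :
  measurable_fun setT (fun x : n.-tuple R => nth 0 x k).
Proof.
have [kn|kn] := ltnP k n; last first.
  rewrite (_ : (fun _ => _) = cst 0)//; apply/funext => x.
  by rewrite nth_default// size_tuple.
rewrite (_ : (fun _ => _) = (fun x => tnth x (Ordinal kn))).
  exact: (measurable_tnth (Ordinal kn)).
by apply/funext => x; rewrite (tnth_nth 0).
Qed.

Context {d} {T : measurableType d} (P : probability T R).

Lemma rectangles_determine_law n (f g : T -> n.-tuple R) :
  measurable_fun setT f -> measurable_fun setT g ->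
  (forall A : 'I_n -> set R, (forall i, measurable (A i)) ->
    P [set w | forall i, A i (tnth (f w) i)] =
    P [set w | forall i, A i (tnth (g w) i)]) ->
  forall A, measurable A -> P (f @^-1` A) = P (g @^-1` A).
Proof.
move=> mf mg fg A mA.
pose F : {mfun T >-> n.-tuple R} :=
  HB.pack f (isMeasurableFun.Build _ _ _ _ _ mf).
pose G : {mfun T >-> n.-tuple R} :=
  HB.pack g (isMeasurableFun.Build _ _ _ _ _ mg).
apply: (measure_unique _ (fun=> setT) (measurable_tuple_rectangles n) _ _ _
  (pushforward P F) (pushforward P G)) => //.
- move=> _ _ [A1 mA1 ->] [A2 mA2 ->]; exists (fun i => A1 i `&` A2 i).
    by move=> i; exact: measurableI.
  apply/seteqP; split=> x /= => [[x1 x2] i|x12]; first by split.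
  by split=> i; have [] := x12 i.
- by move=> _; exists (fun=> setT) => //; apply/seteqP; split.
- by rewrite bigcup_const//; exists 0%N.
- by move=> _ [B mB ->]; exact: fg.
- move=> _; rewrite -ge0_fin_numE// fin_num_measure//.
  by rewrite -[X in measurable X]setTI; exact: (measurable_funP F).
Qed.

Lemma mutually_independent_rectangle n (Y : 'I_n -> T -> R)
    (A : 'I_n -> set R) : mutually_independent P Y ->
  (forall i, measurable (A i)) ->
  P [set w | forall i, A i (Y i w)] = (\prod_(i < n) P (Y i @^-1` A i))%E.
Proof.
move=> indY mA; rewrite -(indY A mA); congr (P _).
by apply/seteqP; split=> w /= AY i; [move=> _|]; exact: AY.
Qed.

Lemma measurable_preimage_opp (A : set R) :
  measurable A -> measurable (-%R @^-1` A).
Proof. by move=> mA; rewrite -[X in measurable X]setTI; exact: oppr_measurable. Qed.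

(** On rectangles, the product rule turns the claim into the symmetry of the single
    variable [Y k], and rectangles determine the law. *)
Lemma sign_flip_law n (Y : 'I_n -> T -> R) (k : 'I_n) :
  (forall i, measurable_fun setT (Y i)) -> mutually_independent P Y ->
  (forall A, measurable A -> P (Y k @^-1` A) = P (Y k @^-1` (-%R @^-1` A))) ->
  forall A : set (n.-tuple R), measurable A ->
    P [set w | A [tuple Y i w | i < n]] =
    P [set w | A [tuple if i == k then - Y i w else Y i w | i < n]].
Proof.
move=> mY indY symY; apply: rectangles_determine_law.
- exact: measurable_mktuple.
- apply: measurable_mktuple => i; case: (i == k) => //.
  exact: measurableT_comp.
move=> A mA.
transitivity (P [set w | forall i, A i (Y i w)]).
  by congr (P _); apply/seteqP; split=> w /= Aw i; have := Aw i;
  rewrite (tnth_mktuple (fun j => Y j w)).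
pose A' i := if i == k then -%R @^-1` A i else A i.
transitivity (P [set w | forall i, A' i (Y i w)]); last first.
  congr (P _); apply/seteqP; split=> w /= Aw i; have := Aw i;
  by rewrite (tnth_mktuple (fun j => if j == k then - Y j w else Y j w)) /A'; case: ifP.
have mA' i : measurable (A' i).
  by rewrite /A'; case: ifP => // _; exact: measurable_preimage_opp.
rewrite !mutually_independent_rectangle//; apply: eq_bigr => i _.
by rewrite /A'; case: eqP => // ->; exact: symY.
Qed.

Lemma same_law_ge0_integral n (f g : T -> n.-tuple R) (h : n.-tuple R -> \bar R) :
  measurable_fun setT f -> measurable_fun setT g ->
  (forall A, measurable A -> P (f @^-1` A) = P (g @^-1` A)) ->
  measurable_fun setT h -> (forall x, 0 <= h x)%E ->
  (\int[P]_w h (f w) = \int[P]_w h (g w))%E.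
Proof.
move=> mf mg fg mh h0.
pose F : {mfun T >-> n.-tuple R} :=
  HB.pack f (isMeasurableFun.Build _ _ _ _ _ mf).
pose G : {mfun T >-> n.-tuple R} :=
  HB.pack g (isMeasurableFun.Build _ _ _ _ _ mg).
transitivity (\int[pushforward P F]_x h x)%E.
  by rewrite ge0_integral_pushforward.
transitivity (\int[pushforward P G]_x h x)%E.
  by apply: eq_measure_integral => A mA _; exact: fg.
by rewrite ge0_integral_pushforward.
Qed.

End TupleLaws.

(** * Kolmogorov's maximal inequality *)

Section Kolmogorov.
Context {R : realType}.
Implicit Types (lam : R) (a z : nat -> R) (n : nat).

(** The partial sums of [a k * z k], frozen from the first time they exceed [lam]
    in absolute value. *)
Fixpoint stopped_sum lam a z n : R :=
  if n is k.+1 then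
    if lam < `|stopped_sum lam a z k| then stopped_sum lam a z k
    else stopped_sum lam a z k + a k * z k
  else 0.

Lemma eq_stopped_sum lam a z z' n : (forall k, (k < n)%N -> z k = z' k) ->
  stopped_sum lam a z n = stopped_sum lam a z' n.
Proof.
elim: n => //= n IH zz'; rewrite zz'// IH// => k kn.
by apply: zz'; exact: ltnW.
Qed.

(** Once frozen, the stopped sum keeps the value that exceeded [lam], so its
    terminal value alone records whether the maximum did. *)
Lemma stopped_sum_exceeds lam a z n j : 0 <= lam -> (j <= n)%N ->
  lam < `|\sum_(k < j) a k * z k| -> lam < `|stopped_sum lam a z n|.
Proof.
move=> lam0 jn; suff [//|[_ /(_ _ jn)]] : lam < `|stopped_sum lam a z n| \/
    stopped_sum lam a z n = \sum_(k < n) a k * z k /\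
    forall i, (i <= n)%N -> `|\sum_(k < i) a k * z k| <= lam.
  by rewrite leNgt => /negP.
elim: n {j jn} => [|n IH] /=.
  right; split=> [|i]; first by rewrite big_ord0.
  by rewrite leqn0 => /eqP ->; rewrite big_ord0 normr0.
case: ifPn => [ltU|]; first by left.
rewrite -leNgt => leU; case: IH => [|[E IH]]; first by rewrite ltNge leU.
have -> : stopped_sum lam a z n + a n * z n = \sum_(k < n.+1) a k * z k.
  by rewrite E big_ord_recr.
case: (ltP lam) => [_|le1]; first by left.
right; split=> // i; rewrite leq_eqVlt => /predU1P[->//|].
by rewrite ltnS => /IH.
Qed.

Lemma measurable_stopped_sum d (T : measurableType d) lam a
    (z : nat -> T -> R) n :
  (forall k, measurable_fun setT (z k)) ->
  measurable_fun setT (fun w => stopped_sum lam a (z^~ w) n).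
Proof.
move=> mz; elim: n => [|n IH] /=; first exact: measurable_cst.
apply: measurable_fun_ifT => //.
  by apply: measurable_fun_ltr => //; exact: measurableT_comp.
apply: measurable_funD => //; apply: measurable_funM => //.
Qed.

Context {d} {T : measurableType d} (P : probability T R).

Section SymmetricIncrements.
Variables (z : nat -> T -> R) (C : R).
Hypothesis mz : forall k, measurable_fun setT (z k).
Hypothesis indz : forall n, mutually_independent P (fun k : 'I_n => z k).
Hypothesis symz : forall k A, measurable A ->
  P (z k @^-1` A) = P (z k @^-1` (-%R @^-1` A)).
Hypothesis varz : forall k, (\int[P]_w (z k w ^+ 2)%:E <= C%:E)%E.

Let measurable_sqr_EFin (f : T -> R) : measurable_fun setT f ->
  measurable_fun setT (fun w => (f w ^+ 2)%:E).
Proof. by move=> mf; apply/measurable_EFinP; exact: measurable_funX. Qed.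

(** One step replaces [U] by [U + a n * z n], or leaves it unchanged if it is
    frozen. By symmetry of [z n] the result has the same second moment as its
    counterpart with [U - a n * z n], and the two squares add up to at most
    [2 * (U ^+ 2 + (a n * z n) ^+ 2)]. *)
Lemma stopped_sum_second_moment lam a n :
  (\int[P]_w (stopped_sum lam a (z^~ w) n ^+ 2)%:E <=
   (C * \sum_(k < n) a k ^+ 2)%:E)%E.
Proof.
elim: n => [|n IH].
  under eq_integral do rewrite /= expr0n/=.
  by rewrite integral0 big_ord0 mulr0.
pose U w := stopped_sum lam a (z^~ w) n.
pose V w := if lam < `|U w| then U w else U w - a n * z n w.
pose nthz (x : n.+1.-tuple R) k := nth 0 x k.
pose h (x : n.+1.-tuple R) := (stopped_sum lam a (nthz x) n.+1 ^+ 2)%:E.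
have mU : measurable_fun setT U by exact: measurable_stopped_sum.
have mV : measurable_fun setT V.
  apply: measurable_fun_ifT => //.
    by apply: measurable_fun_ltr => //; exact: measurableT_comp.
  by apply: measurable_funB => //; exact: measurable_funM.
have mh : measurable_fun setT h.
  apply/measurable_EFinP; apply: measurable_funX.
  apply: (measurable_stopped_sum _ _ (z := fun k x => nthz x k)) => k.
  exact: measurable_nth0.
(* [V] is the next stopped sum with [z n] replaced by [- z n]: it is the value of
   [h] at the tuple whose last entry has its sign flipped. *)
pose flip (k : 'I_n.+1) w := if k == ord_max then - z k w else z k w.
have UV : (\int[P]_w (stopped_sum lam a (z^~ w) n.+1 ^+ 2)%:E =
           \int[P]_w (V w ^+ 2)%:E)%E.
  transitivity (\int[P]_w h [tuple z i w | i < n.+1])%E.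
    apply: eq_integral => w _; rewrite /h; congr ((_ ^+ 2)%:E).
    apply: eq_stopped_sum => k kn.
    by rewrite /nthz (nth_mktuple _ _ (Ordinal kn)).
  rewrite (@same_law_ge0_integral _ _ _ P n.+1 _
      (fun w => [tuple flip i w | i < n.+1]))//; first last.
  - by move=> x; rewrite lee_fin sqr_ge0.
  - move=> A mA; apply: (sign_flip_law (k := ord_max) _ (indz (n:=n.+1))) mA => //.
    exact: symz.
  - apply: measurable_mktuple => i; rewrite /flip.
    by case: (i == _) => //; exact: measurableT_comp.
  - exact: measurable_mktuple.
  apply: eq_integral => w _; rewrite /h /V /=.
  rewrite (_ : stopped_sum lam a (nthz _) n = U w).
    rewrite /nthz (nth_mktuple _ _ ord_max) /flip eqxx mulrN.
    by case: ifP.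
  apply: eq_stopped_sum => k kn.
  rewrite /nthz (nth_mktuple _ _ (Ordinal (ltnW kn : (k < n.+1)%N))) /flip.
  by rewrite -val_eqE/= (ltn_eqF kn).
have parallelogram : (\int[P]_w (stopped_sum lam a (z^~ w) n.+1 ^+ 2)%:E +
    \int[P]_w (stopped_sum lam a (z^~ w) n.+1 ^+ 2)%:E <=
    2%:E * (\int[P]_w (U w ^+ 2)%:E +
            (a n ^+ 2)%:E * \int[P]_w (z n w ^+ 2)%:E))%E.
  rewrite [in X in (_ + X)%E]UV -ge0_integralD//=; first last.
  - exact: measurable_sqr_EFin.
  - by move=> w _; rewrite lee_fin sqr_ge0.
  - apply: measurable_sqr_EFin.
    exact: (measurable_stopped_sum lam a n.+1 mz).
  - by move=> w _; rewrite lee_fin sqr_ge0.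
  rewrite -ge0_integralZl_EFin ?sqr_ge0//; first last.
  - exact: measurable_sqr_EFin.
  - by move=> w _; rewrite lee_fin sqr_ge0.
  have mz2 : measurable_fun setT (fun w => ((a n ^+ 2)%:E * (z n w ^+ 2)%:E)%E).
    by apply: emeasurable_funM => //; exact: measurable_sqr_EFin.
  rewrite -ge0_integralD//; first last.
  - by move=> w _; rewrite -EFinM lee_fin mulr_ge0 ?sqr_ge0.
  - exact: measurable_sqr_EFin.
  - by move=> w _; rewrite lee_fin sqr_ge0.
  rewrite -ge0_integralZl_EFin//; first last.
  - apply: emeasurable_funD => //; exact: measurable_sqr_EFin.
  - by move=> w _; rewrite adde_ge0 ?mule_ge0 ?lee_fin ?sqr_ge0.
  apply: ge0_le_integral => //.
  - by move=> w _; rewrite -EFinD lee_fin addr_ge0 ?sqr_ge0.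
  - apply: emeasurable_funD; apply: measurable_sqr_EFin => //.
    exact: (measurable_stopped_sum lam a n.+1 mz).
  - apply: emeasurable_funM => //; apply: emeasurable_funD => //.
    exact: measurable_sqr_EFin.
  move=> w _; rewrite -(EFinM (a n ^+ 2)) -!EFinD -(EFinM 2) lee_fin /V -/(U w).
  have az : 0 <= (a n * z n w) ^+ 2 by exact: sqr_ge0.
  by case: ifP => _; nra.
have : (\int[P]_w (stopped_sum lam a (z^~ w) n.+1 ^+ 2)%:E +
    \int[P]_w (stopped_sum lam a (z^~ w) n.+1 ^+ 2)%:E <=
    2%:E * ((C * \sum_(k < n) a k ^+ 2)%:E + (a n ^+ 2 * C)%:E))%E.
  apply: (le_trans parallelogram).
  rewrite lee_pmul2l// leeD// (EFinM (a n ^+ 2) C) lee_wpmul2l// lee_fin.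
  exact: sqr_ge0.
have : (0 <= \int[P]_w (stopped_sum lam a (z^~ w) n.+1 ^+ 2)%:E)%E.
  by apply: integral_ge0 => w _; rewrite lee_fin sqr_ge0.
case: (integral _ _ _) => [x|//|//] _.
rewrite -EFinD -EFinM !lee_fin big_ord_recr/=.
by lra.
Qed.

(** Markov's inequality for the square of the stopped sum. *)
Lemma kolmogorov_inequality a n lam : 0 < lam ->
  (P [set w | lam < \big[Num.max/0]_(1 <= j < n.+1)
                `|\sum_(k < j) a k * z k w|]%R <=
   (C * (\sum_(k < n) a k ^+ 2) / lam ^+ 2)%:E)%E.
Proof.
move=> lam0; have lam20 : 0 < lam ^+ 2 by rewrite exprn_gt0.
pose U w := stopped_sum lam a (z^~ w) n.
have mU : measurable_fun setT U by exact: measurable_stopped_sum.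
rewrite EFinM lee_pdivlMr// muleC.
apply: le_trans (stopped_sum_second_moment lam a n).
have := @le_integral_abse _ _ _ P setT measurableT
  (fun w => (U w ^+ 2)%:E) (lam ^+ 2) (measurable_sqr_EFin mU) lam20.
under eq_integral do rewrite gee0_abs ?lee_fin ?sqr_ge0//.
apply: le_trans; rewrite lee_pmul2l ?lte_fin//.
apply: le_measure; rewrite ?inE.
- apply: measurable_gt; apply: measurable_bigmax => j.
  apply: measurableT_comp => //; apply: measurable_sum => k.
  exact: measurable_funM.
- rewrite setTI (_ : [set w | _] = (fun w => U w ^+ 2) @^-1` `[lam ^+ 2, +oo[%classic).
    by rewrite -[X in measurable X]setTI; exact: measurable_funX.
  apply/seteqP; split=> w /=;
  by rewrite in_itv/= andbT lee_fin ger0_norm ?sqr_ge0.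
move=> w /= lt; split=> //; rewrite lee_fin ger0_norm ?sqr_ge0//.
rewrite -[leRHS]real_normK ?num_real// lerXn2r ?nnegrE//; first exact: ltW.
rewrite ltW//.
apply: contraTT lt; rewrite -!leNgt => leU.
apply: bigmax_nat_le => [|j /andP[_]]; first exact: ltW.
rewrite ltnS => jn; rewrite leNgt; apply/negP.
move=> /(stopped_sum_exceeds (z := z^~ w) (ltW lam0) jn).
by rewrite ltNge leU.
Qed.

End SymmetricIncrements.
End Kolmogorov.

(** * Second moment of the normal law *)

Section Density.
Context d (T : measurableType d) (R : realType).
Variables (mu nu : {measure set T -> \bar R}) (p : T -> R).
Hypothesis mp : measurable_fun setT p.
Hypothesis p0 : forall x, 0 <= p x.
Hypothesis nuE : forall A, measurable A -> nu A = (\int[mu]_(x in A) (p x)%:E)%E.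
Local Open Scope ereal_scope.

Import HBNNSimple.

Let integral_density_indic A : measurable A ->
  \int[nu]_x (\1_A x)%:E = \int[mu]_x ((\1_A x)%:E * (p x)%:E).
Proof.
move=> mA; rewrite integral_indic// setIT nuE// integral_mkcond.
apply: eq_integral => x _; rewrite patchE indicE.
by case: ifP => _; rewrite ?mul1e ?mul0e.
Qed.

Let integral_density_nnsfun (f : {nnsfun T >-> R}) :
  \int[nu]_x (f x)%:E = \int[mu]_x ((f x)%:E * (p x)%:E).
Proof.
under [LHS]eq_integral do rewrite fimfunE -fsumEFin//.
rewrite [LHS]ge0_integral_fsum//; last 2 first.
  - by move=> r; exact/measurable_EFinP/measurableT_comp.
  - by move=> n x _; rewrite EFinM nnfun_muleindic_ge0.
under [RHS]eq_integral.
  move=> x xD; rewrite fimfunE -fsumEFin// muleC ge0_mule_fsumr; last first.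
    by move=> r; rewrite EFinM nnfun_muleindic_ge0.
  over.
rewrite [RHS]ge0_integral_fsum//; last 2 first.
  - move=> r; apply/measurable_EFinP; apply: measurable_funM => //.
    exact: measurable_funM.
  - move=> n x _; rewrite mule_ge0 ?lee_fin// -lee_fin EFinM.
    by rewrite nnfun_muleindic_ge0.
apply: eq_fsbigr => r _.
transitivity (r%:E * \int[nu]_x (\1_(f @^-1` [set r]) x)%:E).
  by rewrite integralZl_indic_nnsfun.
rewrite integral_density_indic//.
have [r0|r0] := ltP r 0%R.
  rewrite preimage_nnfun0//.
  rewrite integral0_eq ?mule0; last by move=> x _; rewrite indic0 mul0e.
  by rewrite integral0_eq//= => x _; rewrite indic0 mulr0 mule0.
rewrite -ge0_integralZl//; last 2 first.
  - by apply: emeasurable_funM => //; apply/measurable_EFinP.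
  - by move=> x _; rewrite mule_ge0 ?lee_fin.
by apply: eq_integral => x _; rewrite EFinM muleA muleC.
Qed.

(** True for indicators by hypothesis, hence for simple functions, hence for
    all nonnegative functions by monotone convergence. *)
Lemma ge0_integral_density (f : T -> \bar R) :
  measurable_fun setT f -> (forall x, 0 <= f x) ->
  \int[nu]_x f x = \int[mu]_x (f x * (p x)%:E).
Proof.
move=> mf f0.
pose f_ := nnsfun_approx measurableT mf.
transitivity (limn (fun n => \int[nu]_x (f_ n x)%:E)).
  rewrite -monotone_convergence//=.
  - apply: eq_integral => ? /[!inE] xD; apply/esym/cvg_lim => //=.
    exact: cvg_nnsfun_approx.
  - by move=> n; exact/measurable_EFinP/measurable_funTS.
  - by move=> n ? _; rewrite lee_fin.
  - by move=> ? _ ? ? mn; rewrite lee_fin; exact/lefP/nd_nnsfun_approx.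
transitivity (limn (fun n => \int[mu]_x ((f_ n x)%:E * (p x)%:E))).
  by apply: congr_lim; apply/funext => n; exact: integral_density_nnsfun.
rewrite -monotone_convergence//=.
- apply: eq_integral => x _; apply: cvg_lim => //.
  by apply: cvgeZr => //; exact: cvg_nnsfun_approx.
- by move=> n; apply: emeasurable_funM; exact/measurable_EFinP.
- by move=> n x _; rewrite mule_ge0 ?lee_fin.
- move=> x _ m n mn; rewrite lee_wpmul2r ?lee_fin//.
  exact/lefP/nd_nnsfun_approx.
Qed.

End Density.

Section NormalMoment.
Context {R : realType}.

(** Only finiteness is claimed: [x ^+ 2] times the standard normal density is at
    most a multiple of the centered normal density of standard deviation 2, which
    integrates to 1. The comparison is [x ^+ 2 <= 4 * expR (3 / 8 * x ^+ 2)]. *)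
Lemma normal_second_moment :
  exists2 C : R, 0 < C & (\int[normal_prob 0 1]_x (x ^+ 2)%:E <= C%:E)%E.
Proof.
have mx2 : measurable_fun setT (fun x : R => (x ^+ 2)%:E).
  by apply/measurable_EFinP; exact: measurable_funX.
have one0 : 1 != 0 :> R by [].
have two0 : 2 != 0 :> R by rewrite pnatr_eq0.
pose C : R := 4 * (normal_peak 1 / normal_peak 2).
have C0 : 0 < C by rewrite mulr_gt0// divr_gt0// normal_peak_gt0.
exists C => //.
rewrite (@ge0_integral_density _ _ _ lebesgue_measure _ (normal_pdf 0 1))//.
- have <- : (\int[lebesgue_measure]_x (C%:E * (normal_pdf 0 2 x)%:E) = C%:E)%E.
    rewrite ge0_integralZl_EFin ?ltW//.
    + by rewrite integral_normal_pdf mule1.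
    + by move=> x _; rewrite lee_fin normal_pdf_ge0.
    + by apply/measurable_EFinP; exact: measurable_normal_pdf.
  apply: ge0_le_integral => //.
  + by move=> x _; rewrite mule_ge0 ?lee_fin ?sqr_ge0 ?normal_pdf_ge0.
  + apply: emeasurable_funM => //; apply/measurable_EFinP.
    exact: measurable_normal_pdf.
  + apply: emeasurable_funM => //; apply/measurable_EFinP.
    exact: measurable_normal_pdf.
  move=> x _; rewrite -!EFinM lee_fin !normal_pdfE// /normal_fun !subr0.
  have -> : C * (normal_peak 2 * expR (- x ^+ 2 / (2 ^+ 2 *+ 2))) =
      normal_peak 1 * (4 * expR (- x ^+ 2 / (2 ^+ 2 *+ 2))).
    by rewrite /C; field; rewrite gt_eqF// normal_peak_gt0.
  rewrite mulrCA ler_wpM2l ?normal_peak_ge0//.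
  rewrite (_ : - x ^+ 2 / (2 ^+ 2 *+ 2) =
    x ^+ 2 * (3 / 8) + - x ^+ 2 / (1 ^+ 2 *+ 2)); last by field.
  rewrite expRD mulrA ler_wpM2r ?expR_ge0//.
  have := expR_ge1Dx (x ^+ 2 * (3 / 8)); have := sqr_ge0 x; lra.
- exact: measurable_normal_pdf.
- by move=> x; exact: normal_pdf_ge0.
- by move=> x; rewrite lee_fin sqr_ge0.
Qed.

End NormalMoment.

(** * Brownian sums and almost sure bounds *)

Section NormalSymmetry.
Context {R : realType}.

Lemma normal_probN (s : R) (A : set R) : s != 0 -> measurable A ->
  normal_prob 0 s (-%R @^-1` A) = normal_prob 0 s A.
Proof.
move=> s0 mA; rewrite /normal_prob.
transitivity (\int[lebesgue_measure]_(x in -%R @^-1` A)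
    ((fun y => (normal_pdf 0 s y)%:E) \o -%R) x)%E.
  by apply: eq_integral => x _ /=; rewrite !normal_pdfE// /normal_fun !subr0 sqrrN.
rewrite -[X in integral _ X _]/((-%R : _ -> measurableTypeR R) @^-1` A).
rewrite -ge0_integral_pushforward//=.
- by apply: eq_measure_integral => X mX _; exact: lebesgue_measureN.
- apply: measurable_funTS; apply/measurable_EFinP; exact: measurable_normal_pdf.
- by move=> x _; rewrite lee_fin normal_pdf_ge0.
Qed.

End NormalSymmetry.

Section BrownianSums.
Context {R : realType} {d} {T : measurableType d} (P : probability T R).

(** The unit increments of a Brownian motion are independent standard normal, so
    they satisfy the hypotheses of Kolmogorov's inequality; the constant bounds
    the second moment of the standard normal law. *)
Lemma brownian_weighted_sum_tail : exists2 C : R, 0 < C &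
  forall B : R -> {RV P >-> R}, standard_brownian_motion B ->
  forall (s : nat -> R) n lam, 0 < lam ->
  (P [set w | lam < \big[Num.max/0]_(1 <= j < n.+1) `|modulated_bm s B j w|]%R
   <= (C * Sigma2 s n / lam ^+ 2)%:E)%E.
Proof.
have [C C0 CE] := @normal_second_moment R.
exists C => // B Bbm s n lam lam0.
pose z k w := B k.+1%:R w - B k%:R w.
have mz k : measurable_fun setT (z k) by exact: measurable_funB.
have zlaw k A : measurable A -> P (z k @^-1` A) = normal_prob 0 1 A.
  move=> mA; have := bm_normal Bbm (ler0n R k) _ mA (t := k.+1%:R).
  rewrite -natrB// subSnn sqrtr1; apply.
  by rewrite ltr_nat.
have indz m : mutually_independent P (fun k : 'I_m => z k).
  apply: (@bm_independent _ _ _ _ _ Bbm m (fun i => i%:R)) => // i j ij.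
  by rewrite ler_nat.
have symz k A : measurable A ->
    P (z k @^-1` A) = P (z k @^-1` (-%R @^-1` A)).
  move=> mA; rewrite !zlaw//; last exact: measurable_preimage_opp.
  by rewrite normal_probN.
have varz k : (\int[P]_w (z k w ^+ 2)%:E <= C%:E)%E.
  apply: le_trans CE; rewrite le_eqVlt; apply/orP; left; apply/eqP.
  have mzk : @measurable_fun _ _ T (measurableTypeR R) setT (z k) by exact: mz.
  pose Z : {mfun T >-> measurableTypeR R} :=
    HB.pack (z k : T -> measurableTypeR R) (isMeasurableFun.Build _ _ _ _ _ mzk).
  transitivity (\int[pushforward P Z]_x (x ^+ 2)%:E)%E.
    rewrite ge0_integral_pushforward//.
    - by apply/measurable_EFinP; exact: measurable_funX.
    - by move=> x _; rewrite lee_fin sqr_ge0.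
  by apply: eq_measure_integral => A mA _; exact: zlaw.
have sumE m (F : nat -> R) : \sum_(1 <= i < m.+1) F i = \sum_(k < m) F k.+1.
  by rewrite big_add1 big_mkord.
have := @kolmogorov_inequality R d T P z C mz indz symz varz
  (fun k => s k.+1) n lam lam0.
rewrite /Sigma2 sumE; apply: le_trans; rewrite le_eqVlt; apply/orP; left; apply/eqP.
congr (P _); apply/funext => w /=.
under eq_bigr => j _ do rewrite /modulated_bm sumE.
by [].
Qed.

(** The superior limit of the exceptional events is negligible, and its
    probability is the limit of those of the unions of the tails. *)
Lemma ae_eventually_le_tail (Y : nat -> T -> R) (a : nat -> R) (eps : R) :
  (forall n, measurable_fun setT (Y n)) ->
  {ae P, forall w, \forall n \near \oo, Y n w <= a n} -> 0 < eps ->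
  \forall n \near \oo, (P [set w | a n < Y n w]%R <= eps%:E)%E.
Proof.
move=> mY aeY eps0; pose F n := [set w | a n < Y n w].
have mF n : measurable (F n) by exact: measurable_gt.
have mU n : measurable (\bigcup_(k >= n) F k) by exact: bigcup_measurable.
have limF0 : P (lim_sup_set F) = 0%E.
  apply: measure_negligible.
    by apply: bigcap_measurable => //; exists 0%N.
  apply: negligibleS aeY => w Fw [N _ NY].
  have [k Nk] := Fw N Logic.I; rewrite /F/= ltNge => /negP; apply.
  exact: NY.
have cvg0 : P (\bigcup_(k >= n) F k) @[n --> \oo] --> 0%E.
  rewrite -limF0; apply: lim_sup_set_cvg => //.
  by rewrite -ge0_fin_numE// fin_num_measure.
have : \forall n \near \oo, (P (\bigcup_(k >= n) F k) < eps%:E)%E.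
  by apply: (cvg0 [set x | (x < eps%:E)%E]); apply: open_ereal_lt'; rewrite lte_fin.
apply: filterS => n /ltW; apply: le_trans; apply: le_measure.
- by rewrite inE; exact: mF.
- by rewrite inE; exact: mU.
- by move=> w Fw; exists n => /=.
Qed.

End BrownianSums.

(** * Weighted sums of a strongly approximated series *)

Section WeightedSums.
Context {R : realType}.

(** With [b 0 = 0] the partial sums of [y i - tau * (b i - b (i - 1))] telescope
    to those of [y] minus [tau * b i]. *)
Lemma weighted_approx_le (s y b : nat -> R) tau n j D : b 0%N = 0 ->
  (1 <= j <= n)%N ->
  (forall i, (1 <= i <= n)%N -> `|\sum_(1 <= k < i.+1) y k - tau * b i| <= D) ->
  `|\sum_(1 <= i < j.+1) s i * y i
    - tau * \sum_(1 <= i < j.+1) s i * (b i - b i.-1)| <= end_variation s n * D.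
Proof.
move=> b0 jn yb.
rewrite (_ : _ - _ = \sum_(1 <= i < j.+1) s i * (y i - tau * (b i - b i.-1))).
  apply: weighted_sum_le => // i iP; rewrite sumrB -mulr_sumr.
  rewrite [X in tau * X](_ : _ = b i) ?yb//.
  by rewrite big_add1 telescope_sumr//= b0 subr0.
by rewrite mulr_sumr -sumrB; apply: eq_bigr => i _; ring.
Qed.

Context {d} {T : measurableType d} (P : probability T R).

Section StrongApproximation.
Variables (y : nat -> T -> R) (tau : R) (B : R -> {RV P >-> R}).
Variable Delta : nat -> R.
Hypothesis Bbm : standard_brownian_motion B.
Hypothesis yB : strong_approx y tau B Delta.

(** The exceptional null set and the threshold on [n] do not depend on the weights,
    so [s] may be chosen afterwards as the [n]-th row of an array. *)
Lemma weighted_sum_strong_approx : {ae P, forall w, \forall n \near \oo,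
  forall (s : nat -> R) j, (1 <= j <= n)%N ->
    `|\sum_(1 <= i < j.+1) s i * y i w - tau * modulated_bm s B j w|
      <= end_variation s n * `|Delta n|}.
Proof.
have := bm_start Bbm; move: yB; rewrite /strong_approx /as_littleo.
apply: filterS2 => w /eqoP /(_ 1 ltr01) yBw B0.
apply: filterS yBw => n; rewrite mul1r => yBw s j jn.
apply: (@weighted_approx_le s (y^~ w) (fun i => B i%:R w)) => // i iP.
apply: le_trans yBw; apply: le_trans (ler_norm _).
exact: (le_bigmax_nat_term (fun i => `|partial_sum y i w - tau * B i%:R w|)).
Qed.

Hypothesis my : forall i, measurable_fun setT (y i).
Hypothesis tau_ge0 : 0 <= tau.
Variable s : nat -> nat -> R.
Hypothesis s_gt0 : forall n i, (1 <= i <= n)%N -> 0 < s n i.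

Let measurable_weighted_sum n j :
  measurable_fun setT (fun w => \sum_(1 <= i < j.+1) s n i * y i w).
Proof. by apply: measurable_sum => i; exact: measurable_funM. Qed.

Let measurable_modulated_bm n j : measurable_fun setT (modulated_bm (s n) B j).
Proof.
apply: measurable_sum => i; apply: measurable_funM => //.
exact: measurable_funB.
Qed.

(** The maximum is at most the approximation error plus [tau] times the maximum of
    the Brownian sum. The first is eventually small in probability because it is
    so almost surely, the second by Kolmogorov's inequality. *)
Lemma weighted_sum_p_bigO :
  p_bigO P
    (fun n w => \big[Num.max/0]_(1 <= j < n.+1)
                  `|\sum_(1 <= i < j.+1) s n i * y i w|)
    (fun n => end_variation (s n) n * `|Delta n| + Num.sqrt (Sigma2 (s n) n)).
Proof.
move=> eps eps0; have [C C0 tailC] := brownian_weighted_sum_tail P.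
(* Kolmogorov's bound at level [L * sqrt (Sigma2 (s n) n)] is [C / L ^+ 2], which
   this choice makes equal to [eps / 2]. *)
pose L := Num.sqrt (2 * C / eps).
have L0 : 0 < L by rewrite sqrtr_gt0 divr_gt0// mulr_gt0.
have L2 : L ^+ 2 = 2 * C / eps by rewrite sqr_sqrtr// divr_ge0 ?mulr_ge0// ltW.
exists (1 + tau * L); first by rewrite ltr_pwDl// mulr_ge0// ltW.
pose Y n w := \big[Num.max/0]_(1 <= j < n.+1)
  `|\sum_(1 <= i < j.+1) s n i * y i w - tau * modulated_bm (s n) B j w|.
pose Z n w := \big[Num.max/0]_(1 <= j < n.+1) `|modulated_bm (s n) B j w|.
pose r n := end_variation (s n) n * `|Delta n|.
have r0 n : 0 <= r n by rewrite mulr_ge0// end_variation_ge0.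
have mY n : measurable_fun setT (Y n).
  apply: measurable_bigmax => j; apply: measurableT_comp => //.
  by apply: measurable_funB => //; exact: measurable_funM.
have mZ n : measurable_fun setT (Z n).
  by apply: measurable_bigmax => j; apply: measurableT_comp.
have mQ n : measurable_fun setT (fun w => \big[Num.max/0]_(1 <= j < n.+1)
    `|\sum_(1 <= i < j.+1) s n i * y i w|).
  by apply: measurable_bigmax => j; exact: measurableT_comp.
have Yr : {ae P, forall w, \forall n \near \oo, Y n w <= r n}.
  apply: filterS weighted_sum_strong_approx => w.
  apply: filterS => n yw; apply: bigmax_nat_le => // j jn; exact: yw.
have eps20 : 0 < eps / 2 by rewrite divr_gt0.
have := ae_eventually_le_tail mY Yr eps20.
have : \forall n \near \oo, (1 <= n)%N by exact: nbhs_infty_ge.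
apply: filterS2 => n n1 YP.
have Sigma0 : 0 < Sigma2 (s n) n.
  rewrite /Sigma2 big_nat_recr//= ltr_wpDl ?exprn_gt0 ?s_gt0 ?n1/=//.
  by rewrite sumr_ge0// => i _; exact: sqr_ge0.
have sqrt0 : 0 < Num.sqrt (Sigma2 (s n) n) by rewrite sqrtr_gt0.
have ZP : (P [set w | L * Num.sqrt (Sigma2 (s n) n) < Z n w]%R <= (eps / 2)%:E)%E.
  apply: le_trans (tailC B Bbm (s n) n _ _) _; first exact: mulr_gt0.
  rewrite lee_fin exprMn L2 sqr_sqrtr; last exact: ltW.
  rewrite le_eqVlt; apply/orP; left; apply/eqP; field.
  by rewrite !gt_eqF.
rewrite (ger0_norm (addr_ge0 (r0 n) (ltW sqrt0))).
apply: (@le_trans _ _ (P ([set w | r n < Y n w] `|`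
    [set w | L * Num.sqrt (Sigma2 (s n) n) < Z n w]))); last first.
  rewrite (splitr eps) EFinD; apply: le_trans (leeD YP ZP).
  by apply: measureU2; exact: measurable_gt.
apply: le_measure.
- rewrite inE; exact: measurable_gt_norm (mQ n).
- by rewrite inE; apply: measurableU; exact: measurable_gt.
move=> w /=; apply: contraPP => /not_orP[/negP]; rewrite -leNgt => Yw /negP.
rewrite -leNgt => Zw; apply/negP; rewrite -leNgt.
rewrite ger0_norm ?bigmax_ge_id//; apply: bigmax_nat_le => [|j jn].
  by rewrite mulr_ge0 ?(addr_ge0 (r0 n) (ltW sqrt0))// addr_ge0// mulr_ge0// ltW.
have Yj := le_trans (le_bigmax_nat_term (fun j =>
  `|\sum_(1 <= i < j.+1) s n i * y i w - tau * modulated_bm (s n) B j w|) jn) Yw.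
have Zj := le_trans (le_bigmax_nat_term (fun j => `|modulated_bm (s n) B j w|) jn) Zw.
rewrite -[X in `|X|](subrK (tau * modulated_bm (s n) B j w)).
apply: (le_trans (ler_normD _ _)); rewrite normrM (ger0_norm tau_ge0).
have := ler_wpM2l tau_ge0 Zj.
have : 0 <= tau * L * r n by rewrite mulr_ge0// mulr_ge0// ltW.
move: Yj (ltW sqrt0); lra.
Qed.

End StrongApproximation.
End WeightedSums.

(** * Change of probability space *)

Section Transfer.
Context {R : realType}.
Context {d} {T : measurableType d} (P : probability T R).
Context {d'} {T' : measurableType d'} (P' : probability T' R).
Variables (e : nat -> T -> R) (e' : nat -> T' -> R).
Hypothesis ee' : same_law P e P' e'.

(** The probability in the definition of [O_p] at rank [n] only depends on the law
    of the first [n] coordinates. *)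
Lemma same_law_p_bigO (f : nat -> (nat -> R) -> R) (a : nat -> R) :
  (forall n y y', (forall i, (1 <= i <= n)%N -> y i = y' i) ->
    f n y = f n y') ->
  (forall n, measurable_fun setT
    (fun x : n.-tuple R => f n (fun i => nth 0 x i.-1))) ->
  p_bigO P' (fun n w => f n (e'^~ w)) a -> p_bigO P (fun n w => f n (e^~ w)) a.
Proof.
move=> loc mf fO eps eps0; have [M M0 fM] := fO eps eps0; exists M => //.
apply: filterS fM => n; apply: le_trans.
have := ee' (measurable_gt_norm (M * `|a n|) (mf n)).
set E := (X in P X = _); set E' := (X in _ = P' X).
rewrite (_ : [set w | _] = E); last first.
  apply/funext => w; rewrite /E /=; congr (is_true (_ < `|_|)).
  apply: loc => -[//|i] /= iltn.
  by rewrite (nth_mktuple _ _ (Ordinal iltn)).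
rewrite (_ : [set w | _] = E'); first by move=> ->.
apply/funext => w; rewrite /E' /=; congr (is_true (_ < `|_|)).
apply: loc => -[//|i] /= iltn.
by rewrite (nth_mktuple _ _ (Ordinal iltn)).
Qed.

Lemma same_law_weighted_sum (g : R -> R) (s : nat -> nat -> R) (a : nat -> R) :
  measurable_fun setT g ->
  p_bigO P' (fun n w => \big[Num.max/0]_(1 <= j < n.+1)
                  `|\sum_(1 <= i < j.+1) s n i * g (e' i w)|) a ->
  p_bigO P (fun n w => \big[Num.max/0]_(1 <= j < n.+1)
                  `|\sum_(1 <= i < j.+1) s n i * g (e i w)|) a.
Proof.
move=> mg; apply: (@same_law_p_bigO (fun n y => \big[Num.max/0]_(1 <= j < n.+1)
                  `|\sum_(1 <= i < j.+1) s n i * g (y i)|)).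
- move=> n y y' yy'; apply: eq_big_nat => j /andP[_ jn].
  congr `|_|; apply: eq_big_nat => i /andP[i1 ij]; rewrite yy'// i1.
  by rewrite -ltnS (leq_trans ij).
- move=> n; apply: measurable_bigmax => j; apply: measurableT_comp => //.
  apply: measurable_sum => i; apply: measurable_funM => //.
  by apply: measurableT_comp => //; exact: measurable_nth0.
Qed.

End Transfer.

Lemma Sigmastar2E (R : realType) (s : nat -> R) n :
  Sigmastar2 s n = Num.sqrt (Sigma2 (fun i => s i ^+ 2) n).
Proof.
by rewrite /Sigmastar2 /Sigma2; under [in RHS]eq_bigr do rewrite -exprM.
Qed.

(** On the range of the maximum [j >= c * n], so that the correction
    [F_j ^+ 2 / j] is at most [F_j ^+ 2 / (c * n)]. *)
Lemma sum_sq_dev_max_le (R : realType) d (T : measurableType d) (mu c : R)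
    (s : nat -> R) (e : nat -> T -> R) n w : (1 <= n)%N -> 0 < c ->
  max_from c n (fun j =>
     `|sum_sq_dev (modulated mu s e) j w - Sigma2 s j|) <=
  \big[Num.max/0]_(1 <= j < n.+1)
     `|\sum_(1 <= i < j.+1) s i ^+ 2 * (e i w ^+ 2 - 1)| +
  (\big[Num.max/0]_(1 <= j < n.+1) `|\sum_(1 <= i < j.+1) s i * e i w|) ^+ 2
    / (c * n%:R).
Proof.
move=> n1 c0; have cn0 : 0 < c * n%:R by rewrite mulr_gt0// ltr0n.
rewrite /max_from; apply: bigmax_le => [|j cnj].
  by rewrite addr_ge0 ?bigmax_ge_id// divr_ge0 ?sqr_ge0 ?(ltW cn0).
have j1 : (1 <= j)%N by rewrite -(@ltr0n R); exact: lt_le_trans cnj.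
have jn : (1 <= j < n.+1)%N by rewrite j1 ltn_ord.
rewrite modulated_sum_sq_dev//; apply: (le_trans (ler_normB _ _)); apply: lerD.
  exact: (le_bigmax_nat_term (fun j =>
    `|\sum_(1 <= i < j.+1) s i ^+ 2 * (e i w ^+ 2 - 1)|)).
rewrite ger0_norm ?divr_ge0 ?sqr_ge0//.
apply: ler_pM; rewrite ?sqr_ge0 ?invr_ge0//; last by rewrite lef_pV2 ?posrE ?ltr0n.
rewrite -real_normK ?num_real// lerXn2r ?nnegrE ?bigmax_ge_id//.
exact: (le_bigmax_nat_term (fun j => `|\sum_(1 <= i < j.+1) s i * e i w|)).
Qed.

Section Measurability.
Context {R : realType} {d} {T : measurableType d}.

Lemma measurable_max_sum_sq_dev (mu c : R) (s : nat -> R) (e : nat -> T -> R) n :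
  (forall i, measurable_fun setT (e i)) ->
  measurable_fun setT (fun w => max_from c n (fun j =>
    `|sum_sq_dev (modulated mu s e) j w - Sigma2 s j|)).
Proof.
move=> me; have mX i : measurable_fun setT (modulated mu s e i).
  by apply: measurable_funD => //; exact: measurable_funM.
apply: measurable_bigmax => j; apply: measurableT_comp => //.
apply: measurable_funB => //; apply: measurable_sum => i.
apply: measurable_funX; apply: measurable_funB => //.
by apply: measurable_funM => //; exact: measurable_sum.
Qed.

End Measurability.

(** * The theorem *)

Unset Implicit Arguments.
Set Strict Implicit.

Theorem theorem2p1 (R : realType)
  (* the stationary series *)
  (d : measure_display) (T : measurableType d) (P : probability T R)
  (e : nat -> {RV P >-> R})
  (e_stationary : stationary P (fun i => e i))
  (e_mean : ('E_P[e 1%N] = 0)%E)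
  (e_var : ('E_P[fun w => (e 1%N w ^+ 2)%R] = 1)%E)
  (tau taustar : R)
  (tau_gt0 : 0 < tau) (taustar_ge0 : 0 <= taustar)
  (tauP : is_long_run_variance P (fun i => e i) (tau ^+ 2))
  (taustarP :
     is_long_run_variance P (fun i w => e i w ^+ 2 - 1) (taustar ^+ 2))
  (* mean, scales (row n is sigma n) and approximation error *)
  (mu : R) (sigma : nat -> nat -> R)
  (sigma_gt0 : forall n i, (1 <= i <= n)%N -> 0 < sigma n i)
  (Delta : nat -> R) (Delta_gt0 : forall n, (1 <= n)%N -> 0 < Delta n)
  (* strong approximation of S, for a copy e1 of the series *)
  (d1 : measure_display) (T1 : measurableType d1) (P1 : probability T1 R)
  (e1 : nat -> {RV P1 >-> R})
  (e1_law : same_law P (fun i => e i) P1 (fun i => e1 i))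
  (B : R -> {RV P1 >-> R}) (B_bm : standard_brownian_motion B)
  (B_approx : strong_approx (fun i => e1 i) tau B Delta)
  (* strong approximation of S^*, for a copy e2 of the series *)
  (d2 : measure_display) (T2 : measurableType d2) (P2 : probability T2 R)
  (e2 : nat -> {RV P2 >-> R})
  (e2_law : same_law P (fun i => e i) P2 (fun i => e2 i))
  (Bstar : R -> {RV P2 >-> R}) (Bstar_bm : standard_brownian_motion Bstar)
  (Bstar_approx :
     strong_approx (fun i w => e2 i w ^+ 2 - 1) taustar Bstar Delta)
  (c : R) (c_gt0 : 0 < c) (c_le1 : c <= 1) :
  as_bigO P1
    (fun n w => max_from c n (fun j =>
       `|centered_sum mu (modulated mu (sigma n) (fun i => e1 i)) j w
         - tau * modulated_bm (sigma n) B j w|))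
    (fun n => end_variation (sigma n) n * Delta n)
  /\
  p_bigO P
    (fun n w => max_from c n (fun j =>
       `|sum_sq_dev (modulated mu (sigma n) (fun i => e i)) j w
         - Sigma2 (sigma n) j|))
    (fun n =>
       (end_variation (sigma n) n ^+ 2 * Delta n ^+ 2 + Sigma2 (sigma n) n)
         / n%:R
       + Sigmastar2 (sigma n) n
       + end_variation (fun i => sigma n i ^+ 2) n * Delta n).
Proof.
split.
  apply: filterS (weighted_sum_strong_approx B_bm B_approx) => w approx_w.
  apply/eqO_exP; exists 1 => //.
  have n_gt0 : \forall n \near \oo, (1 <= n)%N by exact: nbhs_infty_ge.
  apply: filterS2 n_gt0 approx_w => n n1 approx_w.
  have r0 := end_variation_ge0 (sigma n) n.
  rewrite mul1r normrM (ger0_norm r0) [leLHS]ger0_norm ?bigmax_ge_id//.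
  rewrite /max_from; apply: bigmax_le => [|j cnj].
    by rewrite mulr_ge0.
  have j1 : (1 <= j)%N.
    by rewrite -(@ltr0n R); apply: lt_le_trans cnj; rewrite mulr_gt0 ?ltr0n.
  rewrite modulated_centered_sum//; apply: approx_w.
  by rewrite j1 -ltnS ltn_ord.
have sigma2_gt0 n i : (1 <= i <= n)%N -> 0 < sigma n i ^+ 2.
  by move=> ?; rewrite exprn_gt0 ?sigma_gt0.
have sqr_centered : measurable_fun setT (fun x : R => x ^+ 2 - 1).
  by apply: measurable_funB => //; exact: measurable_funX.
have linO := same_law_weighted_sum e1_law (g := id) (@measurable_id _ _ _)
  (weighted_sum_p_bigO B_bm B_approx (fun i => measurable_funP (e1 i))
     (ltW tau_gt0) sigma_gt0).
have sqrO := same_law_weighted_sum e2_law sqr_centered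
  (weighted_sum_p_bigO Bstar_bm Bstar_approx
     (fun i => measurableT_comp sqr_centered (measurable_funP (e2 i)))
     taustar_ge0 sigma2_gt0).
move=> eps eps0; have eps20 : 0 < eps / 2 by rewrite divr_gt0.
have [M1 M10 lin_tail] := linO _ eps20; have [M2 M20 sqr_tail] := sqrO _ eps20.
(* The factor 2 comes from [(x + y) ^+ 2 <= 2 * (x ^+ 2 + y ^+ 2)], applied to the
   square of the two-term bound on [max |F_j|]. *)
exists (M2 + 2 * M1 ^+ 2 / c).
  by rewrite addr_gt0// divr_gt0// mulr_gt0// exprn_gt0.
have n_gt0 : \forall n \near \oo, (1 <= n)%N by exact: nbhs_infty_ge.
apply: filterS3 n_gt0 lin_tail sqr_tail => n n1.
set Q1 := fun w : T => \big[Num.max/0]_(1 <= j < n.+1)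
  `|\sum_(1 <= i < j.+1) sigma n i * id (e i w)|.
set Q2 := fun w : T => \big[Num.max/0]_(1 <= j < n.+1)
  `|\sum_(1 <= i < j.+1) sigma n i ^+ 2 * (e i w ^+ 2 - 1)|.
rewrite -Sigmastar2E (gtr0_norm (Delta_gt0 n n1)).
set rD := end_variation (sigma n) n * Delta n.
set rD' := end_variation (fun i => sigma n i ^+ 2) n * Delta n.
set S := Sigma2 (sigma n) n; set S' := Sigmastar2 (sigma n) n.
have rD0 : 0 <= rD by rewrite mulr_ge0 ?end_variation_ge0// ltW// Delta_gt0.
have rD'0 : 0 <= rD' by rewrite mulr_ge0 ?end_variation_ge0// ltW// Delta_gt0.
have S0 : 0 <= S by rewrite sumr_ge0// => i _; exact: sqr_ge0.
have S'0 : 0 <= S' by exact: sqrtr_ge0.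
have nR0 : 0 < n%:R :> R by rewrite ltr0n.
rewrite -exprMn -/rD.
set a := (rD ^+ 2 + S) / n%:R + S' + rD'.
have a0 : 0 <= a by rewrite !addr_ge0// divr_ge0 ?addr_ge0 ?sqr_ge0// ltW.
rewrite (ger0_norm a0) (ger0_norm (addr_ge0 rD0 (sqrtr_ge0 S))).
rewrite (ger0_norm (addr_ge0 rD'0 S'0)) => Q1P Q2P.
have mQ1 : measurable_fun setT Q1.
  apply: measurable_bigmax => j; apply: measurableT_comp => //.
  by apply: measurable_sum => i; exact: measurable_funM.
have mQ2 : measurable_fun setT Q2.
  apply: measurable_bigmax => j; apply: measurableT_comp => //.
  apply: measurable_sum => i; apply: measurable_funM => //.
  exact: measurableT_comp sqr_centered _.
apply: (@le_trans _ _ (P ([set w | M1 * (rD + Num.sqrt S) < `|Q1 w|] `|`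
    [set w | M2 * (rD' + S') < `|Q2 w|]))); last first.
  rewrite (splitr eps) EFinD; apply: le_trans (leeD Q1P Q2P).
  by apply: measureU2; exact: measurable_gt_norm.
apply: le_measure.
- rewrite inE; apply: measurable_gt_norm; apply: measurable_max_sum_sq_dev.
  by move=> i; exact: measurable_funP.
- by rewrite inE; apply: measurableU; exact: measurable_gt_norm.
move=> w /=; apply: contraPP => /not_orP[/negP]; rewrite -leNgt => Q1w /negP.
rewrite -leNgt => Q2w; apply/negP; rewrite -leNgt.
rewrite ger0_norm ?bigmax_ge_id//.
apply: le_trans (sum_sq_dev_max_le mu (sigma n) (fun i => e i) w n1 c_gt0) _.
rewrite -/(Q1 w) -/(Q2 w).
have Q1sq : Q1 w ^+ 2 <= 2 * M1 ^+ 2 * (rD ^+ 2 + S).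
  rewrite -real_normK ?num_real//.
  have : `|Q1 w| ^+ 2 <= (M1 * (rD + Num.sqrt S)) ^+ 2.
    by rewrite lerXn2r ?nnegrE// mulr_ge0 ?addr_ge0 ?sqrtr_ge0// ltW.
  move=> /le_trans; apply; rewrite exprMn -[in leRHS](sqr_sqrtr S0).
  have : 0 <= M1 ^+ 2 * (rD - Num.sqrt S) ^+ 2 by rewrite mulr_ge0 ?sqr_ge0.
  lra.
have Q1n : Q1 w ^+ 2 / (c * n%:R) <= 2 * M1 ^+ 2 / c * ((rD ^+ 2 + S) / n%:R).
  rewrite ler_pdivrMr ?mulr_gt0//.
  rewrite [leRHS](_ : _ = 2 * M1 ^+ 2 * (rD ^+ 2 + S))//.
  by field; rewrite !gt_eqF.
have Q2n := le_trans (ler_norm _) Q2w.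
apply: le_trans (lerD Q2n Q1n) _.
have K0 : 0 <= 2 * M1 ^+ 2 / c by rewrite divr_ge0 ?mulr_ge0 ?sqr_ge0// ltW.
have A0 : 0 <= (rD ^+ 2 + S) / n%:R.
  by rewrite divr_ge0 ?addr_ge0 ?sqr_ge0// ltW.
rewrite /a; move: (2 * M1 ^+ 2 / c) ((rD ^+ 2 + S) / n%:R) K0 A0 => K A K0 A0.
have := mulr_ge0 (ltW M20) A0; have := mulr_ge0 K0 (addr_ge0 S'0 rD'0); lra.
Qed.
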